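(* Let $q\in[1,+\infty]$ with conjugate exponent $p$, let $\mathbf K:X\times X\to\mathcal L(\mathcal B_p,\mathcal B_q)$ satisfy (A1), (A2) and (A3), let $\mathbf x=\{x_1,\dots,x_m\}\subseteq X$ be pairwise distinct and let $\beta_m\ge1$. Then $$\min_{f\in\mathcal I_{\mathbf x}(\mathbf y)}\|f\|_{\mathcal B_{\mathbf K}}\ \ge\ \frac1{\beta_m}\min_{f\in\mathcal I_{\mathbf x}(\mathbf y)\cap\mathcal S^{\mathbf x}}\|f\|_{\mathcal B_{\mathbf K}}\qquad\text{for every }\mathbf y\in\mathcal B_q^m$$ holds if and only if $$\|\mathbf K[\mathbf x]^{-1}\mathbf K_{\mathbf x}(x)\|_{p,1}\le\beta_m\qquad\text{for all }x\in X.$$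
   Context: $1/p+1/q=1$. $\mathcal B_p$ denotes the complex sequence space $\ell^2$ if $p=2$ and $(\mathbb C^n,\|\cdot\|_p)$ (fixed $n$) if $p\ne2$; $\mathcal B_q$ is defined in the same way from $q$. $\mathcal L(\mathcal B_p,\mathcal B_q)$ is the space of bounded linear operators with the operator norm. $X$ is a nonempty set. For $v=(v_1,\dots,v_m)\in\mathcal B_p^m$, $\|v\|_{p,1}=\sum_i\|v_i\|_p$. For pairwise distinct $\mathbf x=\{x_1,\dots,x_m\}\subseteq X$, $\mathbf K[\mathbf x]$ is the $m\times m$ operator matrix with $(k,i)$ entry $\mathbf K(x_i,x_k)$, so that $\mathbf K[\mathbf x]\mathbf c=(\sum_i\mathbf K(x_i,x_k)c_i)_k$, and $\mathbf K_{\mathbf x}(x)=(\mathbf K(x,x_i):i=1,\dots,m)^T$ is viewed as an operator $\mathcal B_p\to\mathcal B_q^m$. For the operator $\mathbf K[\mathbf x]^{-1}\mathbf K_{\mathbf x}(x):\mathcal B_p\to\mathcal B_p^m$, $\|\mathbf K[\mathbf x]^{-1}\mathbf K_{\mathbf x}(x)\|_{p,1}=\sup_{c\in\mathcal B_p,c\ne0}\|\mathbf K[\mathbf x]^{-1}\mathbf K_{\mathbf x}(x)c\|_{p,1}/\|c\|_p$. Assumptions on $\mathbf K$: (A1) for all $m$ and pairwise distinct $\mathbf x=\{x_1,\dots,x_m\}$, $\mathbf K[\mathbf x]:\mathcal B_p^m\to\mathcal B_q^m$ has a two-sided inverse $\mathbf K[\mathbf x]^{-1}$ with entries in $\mathcal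 L(\mathcal B_q,\mathcal B_p)$. (A2) there is $\kappa>0$ with $\|\mathbf K(x,x')\|\le\kappa$ for all $x,x'\in X$. (A3) for any finite or countably infinite family of pairwise distinct $x_i\in X$ and $c_i\in\mathcal B_p$ with $\sum_i\|c_i\|_p<\infty$, if $\sum_i\mathbf K(x_i,x)c_i=0$ for all $x\in X$, then all $c_i=0$. $\mathcal B_{\mathbf K}$ is the Banach space of functions $X\to\mathcal B_q$ of the form $\sum_{x\in\operatorname{supp}C}\mathbf K(x,\cdot)c_x$, where $C=(c_x)_{x\in X}$ is a family in $\mathcal B_p$ with countable support and $\sum_x\|c_x\|_p<\infty$, with norm $\sum_x\|c_x\|_p$. $\mathcal S^{\mathbf x}=\{\sum_{j=1}^m\mathbf K(x_j,\cdot)c_j:c_j\in\mathcal B_p\}$ and $\mathcal I_{\mathbf x}(\mathbf y)=\{f\in\mathcal B_{\mathbf K}:f(x_i)=y_i,\ i=1,\dots,m\}$. A minimum whose attainment is not guaranteed is understood as an infimum. *)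

(* Defs.v *)
From HB Require Import structures.
From mathcomp Require Import all_boot all_order all_algebra.
From mathcomp Require Import all_classical all_reals all_analysis.
From mathcomp Require Import complex lra.

Set Implicit Arguments.
Unset Strict Implicit.
Unset Printing Implicit Defensive.
Import Order.TTheory GRing.Theory Num.Theory.
Import numFieldNormedType.Exports.
Import ComplexField.Normc.
Local Open Scope classical_set_scope.
Local Open Scope ring_scope.

Section Ell2.
Variable R : realType.
Implicit Types u v : nat -> R[i]^o.

Definition ell2_sum u : \bar R := (\sum_(0 <= k <oo) ((normc (u k)) ^+ 2)%:E)%E.

Definition square_summable : {pred nat -> R[i]^o} :=
  fun u => `[< (ell2_sum u < +oo)%E >].

Lemma square_summable_submod : submod_closed square_summable.
Proof.
have normc_ge0 (z : R[i]) : 0 <= normc z by case: z => a b; exact: sqrtr_ge0.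
have ge0 u k : (0 <= ((normc (u k)) ^+ 2)%:E)%E by rewrite lee_fin sqr_ge0.
split.
  apply/asboolP; rewrite /ell2_sum eseries0 ?ltry// => k _ _ /=.
  by rewrite expr0n addr0 sqrtr0 expr0n.
move=> a u v /asboolP hu /asboolP hv; apply/asboolP.
pose A := 2 * (normc a) ^+ 2.
have A0 : 0 <= A by rewrite mulr_ge0 ?sqr_ge0.
apply: (@le_lt_trans _ _
  (A%:E * ell2_sum u + 2%:E * ell2_sum v)%E); last first.
  by rewrite lte_add_pinfty// lte_mul_pinfty.
rewrite /ell2_sum -!nneseriesZl// -nneseriesD//; last 2 first.
- by move=> k _ _; rewrite mule_ge0.
- by move=> k _ _; rewrite mule_ge0.
apply: lee_nneseries => // k _.
rewrite -!EFinM -EFinD lee_fin.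
have h : normc (a * u k + v k) <= normc a * normc (u k) + normc (v k).
  by rewrite (le_trans (le_normcD _ _))// normcM.
set x := normc a * normc (u k) in h *; set y := normc (v k) in h *.
have y0 : 0 <= y by exact: normc_ge0.
apply: (@le_trans _ _ ((x + y) ^+ 2)).
  by rewrite ler_pXn2r// nnegrE ?normc_ge0// (le_trans _ h)// normc_ge0.
rewrite /A -mulrA -exprMn -/x; have := sqr_ge0 (x - y); lra.
Qed.

HB.instance Definition _ := GRing.isSubmodClosed.Build _ _ square_summable
  square_summable_submod.

Record ell2 := Ell2 { ell2_seq :> nat -> R[i]^o;
                      _ : ell2_seq \in square_summable }.
HB.instance Definition _ := [isSub for ell2_seq].
HB.instance Definition _ := [Choice of ell2 by <:].
HB.instance Definition _ := [SubChoice_isSubLmodule of ell2 by <:].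

Definition ell2_norm (u : ell2) : R := Num.sqrt (fine (ell2_sum u)).

End Ell2.

Definition cvec_norm (R : realType) (n : nat) (p : \bar R) (v : 'cV[R[i]]_n) : R :=
  match p with
  | r%:E => (\sum_(i < n) (normc (v i 0)) `^ r) `^ r^-1
  | +oo%E => \big[Num.max/0]_(i < n) normc (v i 0)
  | -oo%E => 0 (* not an exponent: p >= 1 *)
  end.

Section Spaces.
Variables (R : realType) (n : nat).
Implicit Types p q : \bar R.

(* The space B_p: l^2 for p = 2 (n is then irrelevant), (C^n, ||.||_p) otherwise. *)
Definition Bsp p : lmodType R[i] :=
  if p == 2%:E then (ell2 R : lmodType R[i]) else 'cV[R[i]]_n.

Definition Bnorm p : Bsp p -> R :=
  if p == 2%:E as b
  return ((if b then (ell2 R : lmodType R[i]) else 'cV[R[i]]_n) : Type) -> R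
  then @ell2_norm R else @cvec_norm R n p.

(* The norm ||v||_{p,1} on B_p^m. *)
Definition Bnorm1 p (m : nat) (v : 'I_m -> Bsp p) : R := \sum_(i < m) Bnorm (v i).

(* The type L(B_p, B_q). *)
Record blin p q := Blin {
  blin_fun :> {linear Bsp p -> Bsp q};
  blin_bounded : exists M : R, forall c, Bnorm (blin_fun c) <= M * Bnorm c }.

End Spaces.
Arguments Bnorm {R n p}.

(* With values in \bar R the norm of an unbounded map is +oo, not a junk value. *)
Definition opnorm (R : realType) (U : zmodType) (V : Type) (nU : U -> R)
    (nV : V -> R) (f : U -> V) : \bar R :=
  ereal_sup [set (nV (f c) / nU c)%:E | c in [set c : U | c != 0]].

(* Unordered convergence for the norm nV; it agrees with convergence of the
   series in any enumeration of D when \sum_D nV (F j) < +oo and V is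
   complete. *)
Definition has_sum (R : realType) (V : zmodType) (nV : V -> R) (J : choiceType)
    (D : set J) (F : J -> V) (s : V) :=
  forall e : R, 0 < e -> exists2 A0, fsets D A0 &
    forall A, fsets D A -> A0 `<=` A -> nV (\sum_(j \in A) F j - s) < e.

Section OperatorMatrices.
Variables (R : realType) (n : nat) (p q : \bar R).

Definition opmx_app (k m : nat) (A : 'M[blin n p q]_(k, m))
    (c : 'I_m -> Bsp n p) : 'I_k -> Bsp n q :=
  fun i => \sum_(j < m) A i j (c j).

(* Two-sided inverse; the default value is irrelevant as soon as one exists. *)
Definition opmx_inv (m : nat) (A : 'M[blin n p q]_m) :
    ('I_m -> Bsp n q) -> 'I_m -> Bsp n p :=
  xget (fun=> 0) [set g | cancel (opmx_app A) g /\ cancel g (opmx_app A)].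

End OperatorMatrices.

Section Kernel.
Variables (R : realType) (n : nat) (p q : \bar R) (X : pointedType).
Variable K : X -> X -> blin n p q.
Local Notation Bp := (Bsp n p).
Local Notation Bq := (Bsp n q).

Definition Kmx (m : nat) (x : 'I_m -> X) : 'M[blin n p q]_m :=
  \matrix_(k < m, i < m) K (x i) (x k).

Definition Kcol (m : nat) (x : 'I_m -> X) (t : X) : 'cV[blin n p q]_m :=
  \col_(i < m) K t (x i).

(* The map K[x]^{-1} K_x(t) : B_p -> B_p^m. *)
Definition KinvKcol (m : nat) (x : 'I_m -> X) (t : X) : Bp -> 'I_m -> Bp :=
  fun c => opmx_inv (Kmx x) (opmx_app (Kcol x t) (fun=> c)).

Definition kernel_invertible := forall (m : nat) (x : 'I_m -> X), injective x ->
  exists L : 'M[blin n q p]_m,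
    cancel (opmx_app (Kmx x)) (opmx_app L) /\
    cancel (opmx_app L) (opmx_app (Kmx x)).

Definition kernel_bounded := exists2 kappa : R, 0 < kappa &
  forall x x' : X, (opnorm Bnorm Bnorm (K x x') <= kappa%:E)%E.

(* A countType is finite or countably infinite. *)
Definition kernel_independent := forall (J : countType) (x : J -> X) (c : J -> Bp),
  injective x ->
  (\esum_(j in [set: J]) (Bnorm (c j))%:E < +oo)%E ->
  (forall t : X, has_sum Bnorm [set: J] (fun j => K (x j) t (c j)) 0) ->
  forall j, c j = 0.

Definition supp (C : X -> Bp) : set X := [set x | C x != 0].

Definition norm1 (C : X -> Bp) : \bar R :=
  \esum_(x in supp C) (Bnorm (C x))%:E.

(* f is the function \sum_(x in supp C) K(x, .) c_x. *)
Definition represents (C : X -> Bp) (f : X -> Bq) :=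
  [/\ countable (supp C), (norm1 C < +oo)%E &
      forall t, has_sum Bnorm (supp C) (fun x => K x t (C x)) (f t)].

Definition BK : set (X -> Bq) := [set f | exists C, represents C f].

(* Under kernel_independent, the family C representing f is unique. *)
Definition BKnorm (f : X -> Bq) : \bar R :=
  norm1 (xget (fun=> 0) [set C | represents C f]).

Definition Sspan (m : nat) (x : 'I_m -> X) : set (X -> Bq) :=
  [set f | exists c : 'I_m -> Bp, f = fun t => \sum_(j < m) K (x j) t (c j)].

Definition interp (m : nat) (x : 'I_m -> X) (y : 'I_m -> Bq) : set (X -> Bq) :=
  [set f | BK f /\ forall i, f (x i) = y i].

Definition min_norm (F : set (X -> Bq)) : \bar R :=
  ereal_inf [set BKnorm f | f in F].

End Kernel.

(* Main.v *)
(* Write L for K[x]^{-1}; the interpolant of y in S^x has coefficients L y, so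
   its norm is ||L y||_{p,1}.  The function K(t, .)c has norm ||c||_p, and the
   interpolant in S^x of its values on x has norm ||L K_x(t) c||_{p,1}: this is
   the direct implication.  Conversely, if f is the sum of the K(s, .)c_s, then
   L applied to the values of f on x differs from a finite partial sum of the
   L K_x(s) c_s by an arbitrarily small amount, since the entries of L are
   bounded, so its norm is at most beta_m times the sum of the ||c_s||_p. *)
Require Import Defs.
From mathcomp Require Import all_boot all_order all_algebra.
From mathcomp Require Import all_classical all_reals all_analysis.
From mathcomp Require Import complex.
From mathcomp Require Import ring lra.
Set Implicit Arguments.
Unset Strict Implicit.
Unset Printing Implicit Defensive.
Import Order.TTheory GRing.Theory Num.Theory.
Import ComplexField.Normc.
Local Open Scope classical_set_scope.
Local Open Scope ring_scope.

(** * The triangle inequality and basic properties of the norms on B_p *)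

Section Norms.
Variable R : realType.

Lemma normc_ge0 (z : R[i]) : 0 <= normc z.
Proof. by case: z => a b; exact: sqrtr_ge0. Qed.

(* Replacing the bounds A and B by positive upper bounds avoids division by
   zero in the convexity proofs of the triangle inequality. *)
Lemma ler_addP (A B N : R) : 0 <= A -> 0 <= B ->
  (forall s t, 0 < s -> 0 < t -> A <= s -> B <= t -> N <= s + t) -> N <= A + B.
Proof.
move=> A0 B0 h; apply/ler_addgt0Pr => e e0.
have := h (A + e / 2) (B + e / 2); lra.
Qed.

(** Convexity of the square at a/s and b/t with weights s/(s+t) and t/(s+t), scaled by (s+t)^2. If
    the a^2 sum to at most s^2 and the b^2 to at most t^2, the right-hand sides sum to at most
    (s+t)s + (s+t)t = (s+t)^2, which is how Minkowski's inequality in l^2 follows. *)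
Lemma sqrD_le_weighted (a b s t : R) : 0 < s -> 0 < t ->
  (a + b) ^+ 2 <= (s + t) / s * a ^+ 2 + (s + t) / t * b ^+ 2.
Proof.
move=> s0 t0; rewrite -subr_ge0.
have -> : (s + t) / s * a ^+ 2 + (s + t) / t * b ^+ 2 - (a + b) ^+ 2 =
          s * t * (a / s - b / t) ^+ 2.
  by field; rewrite !gt_eqF.
by rewrite mulr_ge0 ?sqr_ge0// mulr_ge0// ltW.
Qed.

(** The same convexity argument for the power r: (a+b)/(s+t) is the convex combination of a/s and
    b/t with weights s/(s+t) and t/(s+t). *)
Lemma powRD_le_weighted (a b s t r : R) : 0 <= a -> 0 <= b -> 0 < s -> 0 < t ->
  1 <= r ->
  ((a + b) / (s + t)) `^ r <=
  s / (s + t) * (a / s) `^ r + t / (s + t) * (b / t) `^ r.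
Proof.
move=> a0 b0 s0 t0 r1; have st0 : 0 < s + t by rewrite addr_gt0.
have l0 : 0 <= s / (s + t) by rewrite divr_ge0// ltW.
have l1 : s / (s + t) <= 1 by rewrite ler_pdivrMr// mul1r lerDl ltW.
have := @convex_powR R r r1 (Itv01 l0 l1) (a / s) (b / t).
have pos c : 0 <= c -> c \in (`[0, +oo[%classic : set R).
  by move=> c0; rewrite inE/= in_itv/= c0.
move=> /(_ (pos _ (divr_ge0 a0 (ltW s0))) (pos _ (divr_ge0 b0 (ltW t0)))).
rewrite convRE [X in X `^ _ <= _ -> _]convRE/=.
have -> : unstable.onem (s / (s + t)) = t / (s + t).
  by rewrite /unstable.onem; field; rewrite gt_eqF.
have -> // : s / (s + t) * (a / s) + t / (s + t) * (b / t) = (a + b) / (s + t).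
by field; rewrite !gt_eqF.
Qed.

Lemma ell2_sum_ge0 (u : nat -> R[i]^o) : (0 <= ell2_sum u)%E.
Proof. by apply: nneseries_ge0 => k _ _; rewrite lee_fin sqr_ge0. Qed.

Lemma ell2_sumE (u : ell2 R) : ell2_sum u = (ell2_norm u ^+ 2)%:E.
Proof.
have /asboolP u_fin : (u : nat -> R[i]^o) \in @square_summable R by case: u.
rewrite /ell2_norm sqr_sqrtr ?fine_ge0 ?ell2_sum_ge0// fineK//.
by rewrite ge0_fin_numE// ell2_sum_ge0.
Qed.

Lemma ell2_norm0 : ell2_norm (0 : ell2 R) = 0.
Proof.
rewrite /ell2_norm /ell2_sum eseries0 ?sqrtr0// => k _ _ /=.
by rewrite expr0n addr0 sqrtr0 expr0n.
Qed.

Lemma ell2_normN (u : ell2 R) : ell2_norm (- u) = ell2_norm u.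
Proof.
rewrite /ell2_norm /ell2_sum; congr (Num.sqrt (fine _)).
by apply: eq_eseriesr => k _; rewrite normcN.
Qed.

Lemma ler_ell2_normD (u v : ell2 R) :
  ell2_norm (u + v) <= ell2_norm u + ell2_norm v.
Proof.
apply: ler_addP; [exact: sqrtr_ge0|exact: sqrtr_ge0|].
move=> s t s0 t0 us vt; have st0 : 0 < s + t := addr_gt0 s0 t0.
rewrite -(@ler_pXn2r _ 2)// ?nnegrE ?sqrtr_ge0 ?(ltW st0)//.
rewrite -lee_fin -ell2_sumE.
pose cs := (s + t) / s; pose ct := (s + t) / t.
have cs0 : 0 <= cs by rewrite divr_ge0// ltW.
have ct0 : 0 <= ct by rewrite divr_ge0// ltW.
apply: (@le_trans _ _ (cs%:E * ell2_sum u + ct%:E * ell2_sum v)%E).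
  have ge0 (w : nat -> R[i]^o) k : (0 <= ((normc (w k)) ^+ 2)%:E)%E.
    by rewrite lee_fin sqr_ge0.
  rewrite /ell2_sum -!nneseriesZl// -nneseriesD//; last 2 first.
  - by move=> k _ _; rewrite mule_ge0.
  - by move=> k _ _; rewrite mule_ge0.
  apply: lee_nneseries => // k _; rewrite -!EFinM -EFinD lee_fin.
  apply: le_trans (sqrD_le_weighted _ _ s0 t0).
  by rewrite ler_pXn2r// ?nnegrE ?addr_ge0 ?normc_ge0// le_normcD.
rewrite !ell2_sumE -!EFinM -EFinD lee_fin.
have hu : cs * ell2_norm u ^+ 2 <= cs * s ^+ 2.
  by rewrite ler_wpM2l// ler_pXn2r// ?nnegrE ?sqrtr_ge0 ?(ltW s0).
have hv : ct * ell2_norm v ^+ 2 <= ct * t ^+ 2.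
  by rewrite ler_wpM2l// ler_pXn2r// ?nnegrE ?sqrtr_ge0 ?(ltW t0).
apply: le_trans (lerD hu hv) _.
rewrite [leLHS](_ : _ = (s + t) ^+ 2)// /cs /ct.
by field; rewrite !gt_eqF.
Qed.

Lemma cvec_norm_ge0 n (p : \bar R) (v : 'cV[R[i]]_n) : 0 <= cvec_norm p v.
Proof.
case: p => [r||]//=; first exact: powR_ge0.
by apply: (big_ind (fun z => 0 <= z)) => // [a b a0 b0|i _];
  rewrite ?le_max ?a0// normc_ge0.
Qed.

Lemma cvec_normN n (p : \bar R) (v : 'cV[R[i]]_n) :
  cvec_norm p (- v) = cvec_norm p v.
Proof.
rewrite /cvec_norm; case: p => [r||]; last by [].
  by congr (_ `^ _); apply: eq_bigr => i _; rewrite mxE normcN.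
by apply: eq_bigr => i _; rewrite mxE normcN.
Qed.

Lemma cvec_norm0 n (p : \bar R) : (1 <= p)%E ->
  cvec_norm p (0 : 'cV[R[i]]_n) = 0.
Proof.
case: p => [r||]; last by [].
  rewrite lee_fin => r1; have r0 : r != 0 by rewrite gt_eqF// (lt_le_trans _ r1).
  rewrite /cvec_norm big1 ?powR0// ?invr_eq0// => i _.
  by rewrite mxE normc0 powR0.
move=> _; rewrite /cvec_norm.
apply: (big_ind (fun z => z = 0)); [by []|move=> a b -> ->|move=> i _].
  by rewrite maxxx.
by rewrite mxE normc0.
Qed.

Lemma powR_le1 (x r : R) : 0 <= x -> 0 < r -> (x `^ r <= 1) = (x <= 1).
Proof.
move=> x0 r0; have one : 1 = 1 `^ r :> R by rewrite powR1.
apply/idP/idP => [|x1]; last by rewrite one ge0_ler_powR ?nnegrE// ltW.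
by apply: contraTT; rewrite -!ltNge => x1; rewrite [ltLHS]one gt0_ltr_powR ?nnegrE.
Qed.

(** Together with [powR_le1], this turns a bound of the norm by c into the condition that the r-th
    powers of the coordinates divided by c sum to at most 1. *)
Lemma sum_powR_cvec_norm n (r c : R) (w : 'cV[R[i]]_n) : 0 < r -> 0 < c ->
  \sum_(i < n) (normc (w i 0) / c) `^ r = (cvec_norm r%:E w / c) `^ r.
Proof.
move=> r0 c0; have ci0 : 0 <= c^-1 by rewrite invr_ge0 ltW.
rewrite powRM ?cvec_norm_ge0//= -powRrM mulVf ?gt_eqF// powRr1; last first.
  by apply: sumr_ge0 => i _; exact: powR_ge0.
by rewrite mulr_suml; apply: eq_bigr => i _; rewrite powRM ?normc_ge0.
Qed.

(** For a finite exponent this is convexity of the unit ball: it contains u/s and v/t, hence also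
    (u+v)/(s+t), by convexity of the power in each coordinate. For the exponent +oo each coordinate
    is bounded directly. *)
Lemma ler_cvec_normD n (p : \bar R) (u v : 'cV[R[i]]_n) : (1 <= p)%E ->
  cvec_norm p (u + v) <= cvec_norm p u + cvec_norm p v.
Proof.
case: p => [r||]//; last first.
  move=> _; apply: bigmax_le => [|i _].
    by rewrite addr_ge0// (@cvec_norm_ge0 _ +oo%E).
  rewrite mxE (le_trans (le_normcD _ _))// lerD//=.
    exact: (@le_bigmax _ _ _ 0 (fun i => normc (u i 0))).
  exact: (@le_bigmax _ _ _ 0 (fun i => normc (v i 0))).
rewrite lee_fin => r1; have r0 : 0 < r by rewrite (lt_le_trans _ r1).
apply: ler_addP; [exact: cvec_norm_ge0|exact: cvec_norm_ge0|].
move=> s t s0 t0 us vt; have st0 : 0 < s + t := addr_gt0 s0 t0.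
have norm_le (w : 'cV[R[i]]_n) (c : R) : 0 < c -> cvec_norm r%:E w <= c ->
    \sum_(i < n) (normc (w i 0) / c) `^ r <= 1.
  move=> c0 wc; rewrite sum_powR_cvec_norm// powR_le1 ?ler_pdivrMr ?mul1r//.
  by rewrite divr_ge0 ?cvec_norm_ge0// ltW.
have uv1 : \sum_(i < n) (normc ((u + v) i 0) / (s + t)) `^ r <= 1.
  apply: (@le_trans _ _ (\sum_(i < n) (s / (s + t) * (normc (u i 0) / s) `^ r +
                                       t / (s + t) * (normc (v i 0) / t) `^ r))).
    apply: ler_sum => i _.
    apply: le_trans (powRD_le_weighted _ _ s0 t0 r1); rewrite ?normc_ge0//.
    rewrite ge0_ler_powR// ?nnegrE ?ler_pM2r ?invr_gt0//.
    - exact: ltW.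
    - by rewrite divr_ge0 ?normc_ge0// ltW.
    - by rewrite divr_ge0 ?addr_ge0 ?normc_ge0// ltW.
    - by rewrite mxE le_normcD.
  rewrite big_split/= -!mulr_sumr.
  have -> : 1 = s / (s + t) * 1 + t / (s + t) * 1 by field; rewrite gt_eqF.
  by apply: lerD; rewrite ler_wpM2l ?norm_le// divr_ge0// ltW.
rewrite -(mul1r (s + t)) -ler_pdivrMr// -(@powR_le1 _ r)//.
  by rewrite -sum_powR_cvec_norm.
by rewrite divr_ge0 ?cvec_norm_ge0// ltW.
Qed.

Variable n : nat.

Lemma Bnorm_ge0 (p : \bar R) (c : Bsp n p) : 0 <= Bnorm c.
Proof.
move: c; rewrite /Bnorm /Bsp; case: (p == 2%:E) => c; first exact: sqrtr_ge0.
exact: cvec_norm_ge0.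
Qed.

Lemma BnormN (p : \bar R) (c : Bsp n p) : Bnorm (- c) = Bnorm c.
Proof.
move: c; rewrite /Bnorm /Bsp; case: (p == 2%:E) => c; first exact: ell2_normN.
exact: cvec_normN.
Qed.

Lemma Bnorm0 (p : \bar R) : (1 <= p)%E -> Bnorm (0 : Bsp n p) = 0.
Proof.
rewrite /Bnorm /Bsp; case: (p == 2%:E) => p1; first exact: ell2_norm0.
exact: cvec_norm0.
Qed.

Lemma ler_BnormD (p : \bar R) (c d : Bsp n p) : (1 <= p)%E ->
  Bnorm (c + d) <= Bnorm c + Bnorm d.
Proof.
move: c d; rewrite /Bnorm /Bsp; case: (p == 2%:E) => c d p1.
  exact: ler_ell2_normD.
exact: ler_cvec_normD.
Qed.

Lemma ler_BnormB (p : \bar R) (c d : Bsp n p) : (1 <= p)%E ->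
  Bnorm (c - d) <= Bnorm c + Bnorm d.
Proof. by move=> p1; rewrite -(BnormN d) ler_BnormD. Qed.

Lemma ler_Bnorm_sum (p : \bar R) (I : Type) (r : seq I) (F : I -> Bsp n p) :
  (1 <= p)%E -> Bnorm (\sum_(i <- r) F i) <= \sum_(i <- r) Bnorm (F i).
Proof.
move=> p1; elim/big_ind2 : _ => // [|c a d b ca db]; first by rewrite Bnorm0.
by rewrite (le_trans (ler_BnormD _ _ p1))// lerD.
Qed.

End Norms.

(** * Unordered sums: reindexing and differences *)

Section HasSum.
Variable R : realType.

Lemma has_sum_reindex (V : zmodType) (nV : V -> R) (I J : choiceType)
    (h : J -> I) (D : set I) (F : I -> V) (s : V) : injective h ->
  D `<=` range h -> (forall i, ~ D i -> F i = 0) ->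
  has_sum nV D F s -> has_sum nV [set: J] (F \o h) s.
Proof.
move=> h_inj Dh F0 sumF e /sumF[A0 [A0_fin A0D] A0P].
(* The preimage of [A0] is finite because [h] is injective. The image of a larger [B] may leave [D];
   it is cut back to [D], since [F] vanishes outside. *)
exists (h @^-1` A0).
  by split=> //; apply: finite_preimage => // i j _ _; exact: h_inj.
move=> B [B_fin _] A0B.
have -> : \sum_(j \in B) (F \o h) j = \sum_(i \in h @` B `&` D) F i.
  rewrite -(fsbig_image _ _ F); last by move=> i j _ _; exact: h_inj.
  apply/esym/fsbig_widen => [i []//|i [Bi /= BDi]].
  by apply: F0 => Di; exact: BDi.
apply: A0P; first by split; [apply: finite_setIl; exact: finite_image|move=> i []].
move=> i A0i; split; last exact: A0D.
by have [j _ ji] := Dh _ (A0D _ A0i); exists j => //; apply: A0B; rewrite /= ji.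
Qed.

Variable n : nat.

Lemma has_sumB (p : \bar R) (I : choiceType) (D : set I) (F G : I -> Bsp n p)
    (s t : Bsp n p) : (1 <= p)%E ->
  has_sum Bnorm D F s -> has_sum Bnorm D G t ->
  has_sum Bnorm D (fun i => F i - G i) (s - t).
Proof.
move=> p1 sumF sumG e e0; have e20 : 0 < e / 2 by rewrite divr_gt0.
have [A [A_fin AD] AP] := sumF _ e20; have [B [B_fin BD] BP] := sumG _ e20.
exists (A `|` B); first by split; [rewrite finite_setU|rewrite subUset].
move=> E [E_fin ED]; rewrite subUset => -[AE BE].
have -> : \sum_(j \in E) (F j - G j) - (s - t) =
    (\sum_(j \in E) F j - s) - (\sum_(j \in E) G j - t).
  by rewrite !fsbig_finite//= sumrB !opprB addrACA addrA addrAC -!addrA;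
    congr (_ + _); rewrite addrCA !addrA.
apply: le_lt_trans (ler_BnormB _ _ p1) _.
by rewrite (splitr e) ltrD// ?AP ?BP.
Qed.

End HasSum.

(** * Operator matrices: boundedness, inverses and linearity *)

Section Operators.
Variables (R : realType) (n : nat).

Lemma opmx_bounded (p q : \bar R) (k m : nat) (A : 'M[blin n p q]_(k, m)) :
  (1 <= q)%E -> exists2 M : R, 0 <= M &
    forall c, Bnorm1 (opmx_app A c) <= M * Bnorm1 c.
Proof.
move=> q1.
have AP i j : exists M : R, 0 <= M /\ forall c, Bnorm (A i j c) <= M * Bnorm c.
  (* The constant in [blin_bounded] carries no sign; the maximum with 0 makes it nonnegative. *)
  have [M MP] := blin_bounded (A i j); exists (Num.max 0 M).
  split=> [|c]; first by rewrite le_max lexx.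
  by rewrite (le_trans (MP c))// ler_wpM2r ?Bnorm_ge0// le_max lexx orbT.
have /choice[M MP] : forall ij : 'I_k * 'I_m, exists M : R,
    0 <= M /\ forall c, Bnorm (A ij.1 ij.2 c) <= M * Bnorm c.
  by move=> ij; exact: AP.
(* A crude constant, the sum of the bounds of all entries, suffices: the norm of each c_j is at most
   the whole norm of c. *)
exists (\sum_(i < k) \sum_(j < m) M (i, j)) => [|c].
  by apply: sumr_ge0 => i _; apply: sumr_ge0 => j _; case: (MP (i, j)).
rewrite mulr_suml; apply: ler_sum => i _.
apply: le_trans (ler_Bnorm_sum _ _ q1) _.
rewrite mulr_suml; apply: ler_sum => j _; have [M0 Mc] := MP (i, j).
apply: le_trans (Mc _) _; rewrite ler_wpM2l//.
by rewrite /Bnorm1 (bigD1 j)//= lerDl sumr_ge0// => l _; exact: Bnorm_ge0.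
Qed.

(** A two-sided inverse of a map is unique, so the choice made by [xget] can only be this one. *)
Lemma opmx_invE (p q : \bar R) (m : nat) (A : 'M[blin n p q]_m)
    (L : 'M[blin n q p]_m) :
  cancel (opmx_app A) (opmx_app L) -> cancel (opmx_app L) (opmx_app A) ->
  opmx_inv A = opmx_app L.
Proof.
move=> AL LA; apply: xget_unique => // g [gA Ag].
by apply/funext => y; rewrite -{1}(LA y) gA.
Qed.

Lemma opmx_appB (p q : \bar R) (k m : nat) (A : 'M[blin n p q]_(k, m))
    (c d : 'I_m -> Bsp n p) i :
  opmx_app A (fun j => c j - d j) i = opmx_app A c i - opmx_app A d i.
Proof. by rewrite -sumrB; apply: eq_bigr => j _; rewrite raddfB. Qed.

Lemma opmx_app_sum (p q : \bar R) (k m : nat) (A : 'M[blin n p q]_(k, m))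
    (I : Type) (r : seq I) (c : I -> 'I_m -> Bsp n p) i :
  opmx_app A (fun j => \sum_(s <- r) c s j) i = \sum_(s <- r) opmx_app A (c s) i.
Proof. by rewrite exchange_big/=; apply: eq_bigr => j _; rewrite raddf_sum. Qed.

End Operators.

(** * Representing families, their uniqueness, and the norm of B_K *)

Section Representations.
Variables (R : realType) (n : nat) (p q : \bar R) (X : pointedType).
Variable K : X -> X -> blin n p q.
Hypotheses (p1 : (1 <= p)%E) (q1 : (1 <= q)%E).

Lemma norm1T (C : X -> Bsp n p) :
  norm1 C = \esum_(s in [set: X]) (Bnorm (C s))%:E.
Proof.
rewrite /norm1 esum_mkcond; apply: eq_esum => s _.
case: ifPn => //; rewrite notin_setE /supp/= => /negP/negbNE/eqP->.
by rewrite Bnorm0.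
Qed.

Lemma sum_Bnorm_le_norm1 (C : X -> Bsp n p) (A : set X) : finite_set A ->
  ((\sum_(s \in A) Bnorm (C s))%:E <= norm1 C)%E.
Proof.
by move=> A_fin; rewrite norm1T; apply: esum_ge; exists A; rewrite ?fsumEFin.
Qed.

(** Brings a representation into the form that [kernel_independent] accepts. The range of [h] may
    exceed the support, so that two families can share one index type. *)
Lemma represents_reindex (J : countType) (h : J -> X) (C : X -> Bsp n p)
    (f : X -> Bsp n q) : injective h -> supp C `<=` range h ->
  represents K C f ->
  (\esum_(j in [set: J]) (Bnorm (C (h j)))%:E < +oo)%E /\
  forall t, has_sum Bnorm [set: J] (fun j => K (h j) t (C (h j))) (f t).
Proof.
move=> h_inj Ch [_ C_fin sumC]; split=> [|t].
  apply: le_lt_trans C_fin; apply: ge_ereal_sup => _ [A [A_fin _] <-].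
  rewrite fsumEFin// -(fsbig_image _ h (fun s => Bnorm (C s))); last first.
    by move=> i j _ _; exact: h_inj.
  by apply: sum_Bnorm_le_norm1; exact: finite_image.
apply: (has_sum_reindex h_inj Ch _ (sumC t)) => s /negP/negbNE/eqP->.
by rewrite raddf0.
Qed.

Hypothesis K_indep : kernel_independent K.

(** The difference of the two families, indexed by the union of their supports, is absolutely
    summable and represents f - f = 0; by (A3) it vanishes. *)
Lemma represents_unique (C C' : X -> Bsp n p) (f : X -> Bsp n q) :
  represents K C f -> represents K C' f -> C = C'.
Proof.
move=> repC repC'; pose S := \bigcup_(b in [set: bool]) supp (if b then C else C').
have /countable_injP[g g_inj] : countable S.
  apply: bigcup_countable => [|[] _]; [|by case: repC|by case: repC'].
  exact/finite_set_countable/finite_finset.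
(* kernel_independent needs a countType of indices: S is coded by naturals. *)
pose J : countType := {k : nat | `[< exists2 s, S s & g s = k >]}.
(* [h] decodes what [g] encodes; the default [point] is never taken, since every element of [J] is
   the code of some element of [S]. *)
pose h (j : J) : X := xget point [set s | S s /\ g s = val j].
have hP j : S (h j) /\ g (h j) = val j.
  apply: (@xgetPex _ point [set s | S s /\ g s = val j]).
  by have /asboolP[s Ss gs] := valP j; exists s.
have h_inj : injective h.
  by move=> i j ij; apply: val_inj; rewrite /= -(hP i).2 -(hP j).2 ij.
have Sh : S `<=` range h.
  move=> s Ss; have gs : `[< exists2 s', S s' & g s' = g s >].
    by apply/asboolP; exists s.
  have [Shj ghj] := hP (exist _ (g s) gs).
  by exists (exist _ (g s) gs) => //; apply: g_inj; rewrite ?inE.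
have [C_fin sumC] := represents_reindex h_inj
  (subset_trans (bigcup_sup (i := true) I) Sh) repC.
have [C'_fin sumC'] := represents_reindex h_inj
  (subset_trans (bigcup_sup (i := false) I) Sh) repC'.
have CC'0 : forall j, C (h j) - C' (h j) = 0.
  apply: (K_indep h_inj) => [|t].
    apply: (@le_lt_trans _ _ (\esum_(j in [set: J])
      ((Bnorm (C (h j)))%:E + (Bnorm (C' (h j)))%:E))%E).
      by apply: le_esum => j _; rewrite -EFinD lee_fin ler_BnormB.
    by rewrite esumD ?lte_add_pinfty// => j _; rewrite lee_fin Bnorm_ge0.
  rewrite -(subrr (f t)).
  rewrite (_ : (fun j => _) = fun j => K (h j) t (C (h j)) - K (h j) t (C' (h j))).
    exact: has_sumB.
  by apply/funext => j; rewrite raddfB.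
apply/funext => s; have [Ss|nSs] := pselect (S s).
  by have [j _ <-] := Sh _ Ss; apply/eqP; rewrite -subr_eq0 CC'0.
have [Cs C's] : C s = 0 /\ C' s = 0.
  by split; apply/eqP/negP => /negP sN0; apply: nSs; [exists true|exists false].
by rewrite Cs C's.
Qed.

(** Uniqueness makes the choice in [BKnorm] harmless: every representing family computes the
    norm. *)
Lemma BKnormE (C : X -> Bsp n p) (f : X -> Bsp n q) :
  represents K C f -> BKnorm K f = norm1 C.
Proof.
move=> repC; rewrite /BKnorm; congr norm1; apply: xget_unique => // C' repC'.
exact: represents_unique repC' repC.
Qed.

Lemma represents_span (m : nat) (x : 'I_m -> X) (a : 'I_m -> Bsp n p) :
  injective x ->
  exists C, represents K C (fun t => \sum_(j < m) K (x j) t (a j)) /\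
            norm1 C = (Bnorm1 a)%:E.
Proof.
(* At most one index contributes, by injectivity, and none does off the range of [x]. *)
move=> x_inj; pose C s := \sum_(j < m | x j == s) a j.
have Cx j : C (x j) = a j.
  rewrite /C (bigD1 j)//= big1 ?addr0// => i /andP[/eqP/x_inj -> ].
  by rewrite eqxx.
have Cout s : ~ range x s -> C s = 0.
  move=> nxs; rewrite /C big1// => j /eqP xj; exfalso.
  by apply: nxs; exists j.
have suppC : supp C `<=` range x.
  by move=> s /eqP Cs; apply: contrapT => /Cout.
have x_fin : finite_set (range x) by exact/finite_image/finite_finset.
have C_fin : finite_set (supp C) by exact: sub_finite_set suppC x_fin.
(* Some a_j may be 0, so the support can be smaller than the range of [x]; the extra nodes add only
   zero terms. *)
have sum_range (V : zmodType) (F : X -> V) : (forall s, C s = 0 -> F s = 0) ->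
    \sum_(s \in supp C) F s = \sum_(j < m) F (x j).
  move=> F0; rewrite (fsbig_widen _ _ _ suppC); last first.
    by move=> s [_ /negP/negbNE/eqP]; exact: F0.
  rewrite fsbig_image; last by move=> i j _ _; exact: x_inj.
  rewrite [RHS](@bigfs _ _ _ _ _ predT) ?index_enum_uniq//.
    by apply: eq_fsbigl; apply/seteqP.
  by move=> i _; rewrite mem_index_enum.
have normC : norm1 C = (Bnorm1 a)%:E.
  rewrite /norm1 esum_fset//; last by move=> s _; rewrite lee_fin Bnorm_ge0.
  rewrite fsumEFin// sum_range => [|s ->]; last exact: Bnorm0.
  by congr (_%:E); apply: eq_bigr => j _; rewrite Cx.
exists C; split=> //; split; first exact: finite_set_countable.
  by rewrite normC ltry.
(* The support is finite, so it is its own witness: no larger subset of it exists, and the error is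
   exactly 0. *)
move=> t e e0; exists (supp C); first exact: fsets_self.
move=> A [_ AC] CA.
have -> : A = supp C by apply/seteqP.
rewrite sum_range => [|s ->]; last exact: raddf0.
under eq_bigr do rewrite Cx.
by rewrite subrr Bnorm0.
Qed.

Lemma BKnorm_span (m : nat) (x : 'I_m -> X) (a : 'I_m -> Bsp n p) :
  injective x ->
  BK K (fun t => \sum_(j < m) K (x j) t (a j)) /\
  BKnorm K (fun t => \sum_(j < m) K (x j) t (a j)) = (Bnorm1 a)%:E.
Proof.
move=> x_inj; have [C [repC normC]] := represents_span a x_inj.
by split; [exists C|rewrite (BKnormE repC)].
Qed.

(** * Interpolation at a fixed finite set of nodes *)

Variables (m : nat) (x : 'I_m -> X) (L : 'M[blin n q p]_m).
Hypotheses (x_inj : injective x).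
Hypotheses (KL : cancel (opmx_app (Kmx K x)) (opmx_app L)).
Hypotheses (LK : cancel (opmx_app L) (opmx_app (Kmx K x))).

(** Invertibility of K[x] forces the coefficients of an interpolant in S^x to be L y, so the infimum
    runs over a single value. *)
Lemma min_norm_interp_Sspan (y : 'I_m -> Bsp n q) :
  min_norm K (interp K x y `&` Sspan K x) = (Bnorm1 (opmx_app L y))%:E.
Proof.
rewrite /min_norm -[RHS]ereal_inf1; congr ereal_inf.
have KmxE a i : opmx_app (Kmx K x) a i = \sum_(j < m) K (x j) (x i) (a j).
  by apply: eq_bigr => j _; rewrite mxE.
apply/seteqP; split=> [_ [f [[_ fy] [a fa]] <-]|_ ->].
  rewrite fa (BKnorm_span a x_inj).2/= -[a in LHS]KL; congr (Bnorm1 (opmx_app _ _))%:E.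
  by apply/funext => i; rewrite -fy fa KmxE.
exists (fun t => \sum_(j < m) K (x j) t (opmx_app L y j)); last first.
  exact: (BKnorm_span _ x_inj).2.
split; last by exists (opmx_app L y).
split; first exact: (BKnorm_span _ x_inj).1.
by move=> i; rewrite -KmxE LK.
Qed.

Lemma KinvKcolE t c :
  KinvKcol K x t c = opmx_app L (fun i => K t (x i) c).
Proof.
rewrite /KinvKcol (opmx_invE KL LK); congr opmx_app; apply/funext => i.
by rewrite /opmx_app big_ord1 mxE.
Qed.

Lemma KinvKcol_le (beta : R) t :
  (opnorm Bnorm (@Bnorm1 R n p m) (KinvKcol K x t) <= beta%:E)%E ->
  forall c, Bnorm1 (KinvKcol K x t c) <= beta * Bnorm c.
Proof.
move=> le_beta c; have [c0|c0] := eqVneq (Bnorm c) 0; last first.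
  rewrite -ler_pdivrMr ?lt_neqAle 1?eq_sym ?c0 ?Bnorm_ge0//.
  rewrite -lee_fin; apply: le_trans le_beta; apply: ereal_sup_ubound.
  by exists c => //=; apply: contraNneq c0 => ->; rewrite Bnorm0.
(* The quotient in opnorm is x / 0 = 0 here, so boundedness is used instead. *)
have [M M0 LM] := opmx_bounded L p1; have [N N0 KN] := opmx_bounded (Kcol K x t) q1.
rewrite /KinvKcol (opmx_invE KL LK) (le_trans (LM _))//.
apply: (@le_trans _ _ (M * (N * Bnorm1 (fun=> c : Bsp n p)))).
  by rewrite ler_wpM2l.
by rewrite /Bnorm1 big_ord1 c0 !mulr0.
Qed.

(** Linearity of L reaches only finite sums, so the values of f at the nodes are split into a
    partial sum and a remainder, whose image under L costs at most e. *)
Lemma span_coef_le (beta : R) (f : X -> Bsp n q) (C : X -> Bsp n p) :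
  0 <= beta ->
  (forall t c, Bnorm1 (KinvKcol K x t c) <= beta * Bnorm c) ->
  represents K C f ->
  ((Bnorm1 (opmx_app L (fun i => f (x i))))%:E <= beta%:E * norm1 C)%E.
Proof.
move=> beta0 Kbeta [_ C_fin sumC].
have C_num : norm1 C \is a fin_num.
  by rewrite ge0_fin_numE// esum_ge0// => s _; rewrite lee_fin Bnorm_ge0.
rewrite -(fineK C_num) -EFinM lee_fin; apply/ler_addgt0Pr => e e0.
have [M M0 LM] := opmx_bounded L p1.
(* A remainder below d at each of the m nodes contributes at most M m d <= e; the added 1 keeps the
   denominator positive. *)
pose d := e / (M * m%:R + 1).
have Mm0 : 0 < M * m%:R + 1 by rewrite ltr_wpDl// mulr_ge0.
have d0 : 0 < d by rewrite divr_gt0.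
have /choice[A0 A0P] : forall i, exists A0, fsets (supp C) A0 /\
    forall A, fsets (supp C) A -> A0 `<=` A ->
    Bnorm (\sum_(s \in A) K s (x i) (C s) - f (x i)) < d.
  by move=> i; have [A0 A0C A0P] := sumC (x i) _ d0; exists A0.
(* Since there are finitely many nodes, one finite partial sum is d-close to f at all of them. *)
pose A := \bigcup_(i in [set: 'I_m]) A0 i.
have A_fin : finite_set A.
  by apply: bigcup_finite => [|i _]; [exact: finite_finset|case: (A0P i) => -[]].
have Ad i : Bnorm (\sum_(s \in A) K s (x i) (C s) - f (x i)) < d.
  apply: (A0P i).2 => [|s]; last by exists i.
  by split=> // s [j _]; exact: (A0P j).1.2.
pose r : seq X := finmap.enum_fset (fset_set A).
pose z i := f (x i) - \sum_(s <- r) K s (x i) (C s).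
have zd : Bnorm1 z <= d * m%:R.
  have -> : d * m%:R = \sum_(i < m) d by rewrite sumr_const card_ord mulr_natr.
  apply: ler_sum => i _.
  by rewrite /z -fsbig_finite// -BnormN opprB ltW.
have Lf i : opmx_app L (fun k => f (x k)) i =
    opmx_app L z i + \sum_(s <- r) KinvKcol K x s (C s) i.
  rewrite (opmx_appB L (fun k => f (x k))
    (fun k => \sum_(s <- r) K s (x k) (C s))).
  rewrite (opmx_app_sum L r (fun s k => K s (x k) (C s))).
  under [X in _ = _ + X]eq_bigr do rewrite KinvKcolE.
  by rewrite subrK.
apply: (@le_trans _ _ (Bnorm1 (opmx_app L z) +
    \sum_(s <- r) Bnorm1 (KinvKcol K x s (C s)))).
  rewrite /Bnorm1 exchange_big/= -big_split/=; apply: ler_sum => i _.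
  rewrite Lf (le_trans (ler_BnormD _ _ p1))// lerD2l.
  exact: ler_Bnorm_sum.
rewrite addrC; apply: lerD.
  apply: (@le_trans _ _ (\sum_(s <- r) beta * Bnorm (C s))).
    by apply: ler_sum => s _; exact: Kbeta.
  rewrite -mulr_sumr ler_wpM2l// -fsbig_finite// -lee_fin fineK//.
  exact: sum_Bnorm_le_norm1.
apply: le_trans (LM _) _; apply: (@le_trans _ _ (M * (d * m%:R))).
  by rewrite ler_wpM2l.
by rewrite mulrCA /d mulrAC ler_pdivrMr// ler_pM2l// lerDl.
Qed.

End Representations.

(** * Equivalence of the comparison of minima and the operator bound *)

Theorem theorem6p2 (R : realType) (n : nat) (p q : \bar R)
    (hp : (1 <= p)%E) (hq : (1 <= q)%E) (hpq : (p^-1 + q^-1 = 1)%E)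
    (X : pointedType) (K : X -> X -> blin n p q)
    (hA1 : kernel_invertible K) (hA2 : kernel_bounded K)
    (hA3 : kernel_independent K)
    (m : nat) (x : 'I_m -> X) (hx : injective x)
    (beta : R) (hbeta : 1 <= beta) :
  (forall y : 'I_m -> Bsp n q,
     (min_norm K (interp K x y) >=
      (beta^-1)%:E * min_norm K (interp K x y `&` Sspan K x))%E)
  <->
  (forall t : X,
     (opnorm (@Bnorm R n p) (@Bnorm1 R n p m) (KinvKcol K x t) <= beta%:E)%E).
Proof.
have beta0 : 0 < beta by rewrite (lt_le_trans _ hbeta).
have [L [KL LK]] := hA1 m x hx.
split=> [min_le t|Kbeta y].
  apply: ge_ereal_sup => _ [c _ <-]; rewrite lee_fin.
  (* If the norm of c is 0, the quotient is 0 by the convention on inverses. *)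
  have [->|c0] := eqVneq (Bnorm c) 0; first by rewrite invr0 mulr0 ltW.
  rewrite ler_pdivrMr ?lt_neqAle 1?eq_sym ?c0 ?Bnorm_ge0//.
  (* K(t, .)c is written as a sum over the one-point family t, so that [BKnorm_span] gives its norm;
     it then competes in the minimum for the data K(t, x_i)c. *)
  pose f s := \sum_(j < 1) K ((fun=> t) j) s ((fun=> c) j).
  have fE s : f s = K t s c by rewrite /f big_ord1.
  have [BKf normf] : BK K f /\ BKnorm K f = (Bnorm1 (fun _ : 'I_1 => c))%:E.
    by apply: BKnorm_span => // i j _; rewrite !ord1.
  have := min_le (fun i => K t (x i) c).
  rewrite (min_norm_interp_Sspan hp hq hA3 hx KL LK) -(KinvKcolE KL LK) => le_min.
  rewrite mulrC -ler_pdivrMr// mulrC -lee_fin EFinM; apply: le_trans le_min _.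
  apply: ereal_inf_lbound; exists f; first by split=> // i; exact: fE.
  by rewrite normf /Bnorm1 big_ord1.
(* For the converse, each interpolant f with its representing family is compared separately with the
   minimum over S^x. *)
apply: le_ereal_inf_tmp => _ [f [[C repC] fy] <-].
rewrite (min_norm_interp_Sspan hp hq hA3 hx KL LK) (BKnormE hp hq hA3 repC).
rewrite lee_pdivrMl//.
rewrite (_ : y = fun i => f (x i)); last by apply/funext => i; rewrite fy.
by apply: span_coef_le repC => //; [exact: ltW|move=> t; exact: KinvKcol_le].
Qed.
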